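(* Let $F,G:[0,1]\to\mathbb{R}$ be bounded functions. Let $u$ be the (bounded) solution of $(DP)$ with boundary data $F$. (i) If $v$ is a bounded supersolution of $(DP)$ with boundary data $G$ and $F\le G$ in $[0,1]$, then $u\le v$ in $\mathbb{T}_m$. (ii) If $v$ is a bounded subsolution of $(DP)$ with boundary data $G$ and $F\ge G$ in $[0,1]$, then $u\ge v$ in $\mathbb{T}_m$.
   Context: Let $m>2$ be an integer and let $\alpha,\beta>0$ with $\alpha+\beta=1$. The directed tree $\mathbb{T}_m$ consists of the empty sequence $\emptyset$ (the root) and all finite sequences $(a_1,\dots,a_k)$, $k\ge1$, with $a_i\in\{0,1,\dots,m-1\}$ (vertices). The set $\mathcal{S}(x)$ of successors of $x$ consists of the $m$ vertices obtained by appending one coordinate to $x$. A branch is an infinite sequence $\pi=(x_1,x_2,\dots)$ of vertices $x_k=(a_1,\dots,a_k)$, and $\partial\mathbb{T}_m$ is the set of branches. Put $\psi(\pi)=\sum_{k\ge1}a_km^{-k}\in[0,1]$; for $F:[0,1]\to\mathbb{R}$, $F(\pi)$ means $F(\psi(\pi))$. A function $u:\mathbb{T}_m\to\mathbb{R}$ is $p$-subharmonious if for all $x\in\mathbb{T}_m$, $$u(x)\le\frac{\alpha}{2}\Big\{\max_{y\in\mathcal{S}(x)}u(y)+\min_{y\in\mathcal{S}(x)}u(y)\Big\}+\frac{\beta}{m}\sum_{y\in\mathcal{S}(x)}u(y),$$ $p$-superharmonious if the opposite inequality holds for all $x$, and $p$-harmonious if it is both. With boundary data $F:[0,1]\to\mathbb{R}$: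 a solution of $(DP)$ is a $p$-harmonious $u$ with $\lim_{k\to\infty}u(x_k)=F(\pi)$ for every $\pi=(x_1,x_2,\dots)\in\partial\mathbb{T}_m$; a supersolution is a $p$-superharmonious $v$ with $\lim_{k\to\infty}v(x_k)\ge F(\pi)$ for every such $\pi$; a subsolution is a $p$-subharmonious $v$ with $\lim_{k\to\infty}v(x_k)\le F(\pi)$ for every such $\pi$. *)

(* Defs.v *)
From HB Require Import structures.
From mathcomp Require Import all_boot all_order all_algebra.
From mathcomp Require Import all_classical all_reals all_analysis.

Set Implicit Arguments.
Unset Strict Implicit.
Unset Printing Implicit Defensive.

Import Order.TTheory GRing.Theory Num.Theory.
Import numFieldNormedType.Exports.

Local Open Scope classical_set_scope.
Local Open Scope ring_scope.

Definition vertex (m : nat) := seq 'I_m.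

Definition successors (m : nat) (x : vertex m) : seq (vertex m) :=
  [seq rcons x a | a <- enum 'I_m].

(* A branch is given by its coordinates: [pi k] is a_(k+1), so that
   [branch_vertex pi k] is x_k = (a_1, ..., a_k). *)
Definition branch (m : nat) := nat -> 'I_m.

Definition branch_vertex (m : nat) (pi : branch m) (k : nat) : vertex m :=
  mkseq pi k.

Definition psi (R : realType) (m : nat) (pi : branch m) : R :=
  limn (series (fun k => (pi k)%:R / m%:R ^+ k.+1 : R)).

(* The starting value [head 0 s] belongs to s, so that these are the genuine
   maximum and minimum, as soon as s is nonempty. *)
Definition seq_max (R : realType) (s : seq R) : R :=
  \big[Num.max/head 0 s]_(r <- s) r.

Definition seq_min (R : realType) (s : seq R) : R :=
  \big[Num.min/head 0 s]_(r <- s) r.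

Definition tree_mean (R : realType) (m : nat) (alpha beta : R)
    (u : vertex m -> R) (x : vertex m) : R :=
  alpha / 2 * (seq_max (map u (successors x)) + seq_min (map u (successors x)))
  + beta / m%:R * \sum_(y <- successors x) u y.

Definition p_subharmonious (R : realType) (m : nat) (alpha beta : R)
    (u : vertex m -> R) : Prop :=
  forall x : vertex m, u x <= tree_mean alpha beta u x.

Definition p_superharmonious (R : realType) (m : nat) (alpha beta : R)
    (u : vertex m -> R) : Prop :=
  forall x : vertex m, tree_mean alpha beta u x <= u x.

Definition p_harmonious (R : realType) (m : nat) (alpha beta : R)
    (u : vertex m -> R) : Prop :=
  p_subharmonious alpha beta u /\ p_superharmonious alpha beta u.

(* Boundary data are total functions on R, evaluated only at [psi R pi],
   which lies in [0, 1]. *)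
Definition DP_solution (R : realType) (m : nat) (alpha beta : R)
    (F : R -> R) (u : vertex m -> R) : Prop :=
  p_harmonious alpha beta u /\
  forall pi : branch m, u (branch_vertex pi k) @[k --> \oo] --> F (psi R pi).

Definition DP_supersolution (R : realType) (m : nat) (alpha beta : R)
    (F : R -> R) (v : vertex m -> R) : Prop :=
  p_superharmonious alpha beta v /\
  forall pi : branch m,
    cvgn (fun k => v (branch_vertex pi k)) /\
    F (psi R pi) <= limn (fun k => v (branch_vertex pi k)).

Definition DP_subsolution (R : realType) (m : nat) (alpha beta : R)
    (F : R -> R) (v : vertex m -> R) : Prop :=
  p_subharmonious alpha beta v /\
  forall pi : branch m,
    cvgn (fun k => v (branch_vertex pi k)) /\
    limn (fun k => v (branch_vertex pi k)) <= F (psi R pi).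

(* Main.v *)
(** If u is p-subharmonious and v is p-superharmonious, then some successor y of
    every vertex x satisfies u(y) - v(y) >= u(x) - v(x): the maximum and the
    minimum over the successors are monotone and commute with the addition of
    constants, hence so does the averaging operator. Starting from a vertex
    where u - v = d > 0, one thus builds a branch along which u - v >= d, which
    contradicts lim u <= lim v along this branch. *)

Require Import Defs.
From HB Require Import structures.
From mathcomp Require Import all_boot all_order all_algebra.
From mathcomp Require Import all_classical all_reals all_analysis.
From mathcomp Require Import ring lra.

Set Implicit Arguments.
Unset Strict Implicit.
Unset Printing Implicit Defensive.

Import Order.TTheory GRing.Theory Num.Theory.
Import numFieldNormedType.Exports.

Local Open Scope classical_set_scope.
Local Open Scope ring_scope.

Lemma seq_max_in (R : realType) (s : seq R) : s != [::] -> seq_max s \in s.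
Proof.
rewrite /seq_max; case: s => [//|a s] _; rewrite big_seq.
elim/big_ind: _ => [|p q p_in q_in|//]; first exact: mem_head.
by rewrite /Order.max; case: ifP.
Qed.

Lemma seq_max_ge (R : realType) (s : seq R) r : r \in s -> r <= seq_max s.
Proof. by move=> rs; exact: le_bigmax_seq. Qed.

Lemma seq_min_in (R : realType) (s : seq R) : s != [::] -> seq_min s \in s.
Proof.
rewrite /seq_min; case: s => [//|a s] _; rewrite big_seq.
elim/big_ind: _ => [|p q p_in q_in|//]; first exact: mem_head.
by rewrite /Order.min; case: ifP.
Qed.

Lemma seq_min_le (R : realType) (s : seq R) r : r \in s -> seq_min s <= r.
Proof. by move=> rs; exact: ge_bigmin_seq. Qed.

Section Comparison.
Variables (R : realType) (m : nat) (alpha beta : R).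
Hypotheses (m_gt0 : (0 < m)%N) (alpha_gt0 : 0 < alpha) (beta_ge0 : 0 <= beta).
Hypothesis alphaDbeta : alpha + beta = 1.
Implicit Types (u v : vertex m -> R) (x y : vertex m).

Lemma size_successors x : size (successors x) = m.
Proof. by rewrite size_map size_enum_ord. Qed.

Lemma map_successors_neq0 u x : map u (successors x) != [::].
Proof. by rewrite -size_eq0 size_map size_successors -lt0n. Qed.

(** Strictness comes from the maximum and the minimum alone, whose weight [alpha / 2] is positive;
    the sum is compared only weakly, as [beta] is nonnegative. *)
Lemma tree_mean_lt u v x (c : R) :
  (forall a, u (rcons x a) < v (rcons x a) + c) ->
  tree_mean alpha beta u x < tree_mean alpha beta v x + c.
Proof.
move=> ltuv.
have {}ltuv y : y \in successors x -> u y < v y + c.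
  by case/mapP => a _ ->; exact: ltuv.
have max_lt : seq_max (map u (successors x)) <
    seq_max (map v (successors x)) + c.
  (* For the maxima, compare at a successor where [u] is largest; for the minima below, at one where
     [v] is smallest. *)
  case/mapP: (seq_max_in (map_successors_neq0 u x)) => y ys ->.
  by rewrite (lt_le_trans (ltuv _ ys))// lerD2r seq_max_ge// map_f.
have min_lt : seq_min (map u (successors x)) <
    seq_min (map v (successors x)) + c.
  case/mapP: (seq_min_in (map_successors_neq0 v x)) => y ys ->.
  by rewrite (le_lt_trans _ (ltuv _ ys))// seq_min_le// map_f.
have sum_le : \sum_(y <- successors x) u y <=
    \sum_(y <- successors x) v y + m%:R * c.
  rewrite /successors !(big_map (rcons x)) !big_enum/=.
  rewrite -[m in m%:R]card_ord mulr_natl -sumr_const.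
  by rewrite -big_split/= ler_sum// => a _; exact/ltW/ltuv/map_f/mem_enum.
have m_neq0 : m%:R != 0 :> R by rewrite pnatr_eq0 -lt0n.
(* Since [alpha + beta = 1], the constant [c] splits into [alpha / 2 * (c + c)] and
   [beta / m%:R * (m%:R * c)]. *)
have -> : tree_mean alpha beta v x + c =
    alpha / 2 * ((seq_max (map v (successors x)) + c) +
                 (seq_min (map v (successors x)) + c)) +
    beta / m%:R * (\sum_(y <- successors x) v y + m%:R * c).
  rewrite /tree_mean -[X in _ + X = _]mul1r -[X in _ + X * c = _]alphaDbeta.
  by field.
apply: ltr_leD; first by rewrite ltr_pM2l ?divr_gt0// ltrD.
by rewrite ler_wpM2l// divr_ge0.
Qed.

Lemma successor_sub_ge u v x :
  p_subharmonious alpha beta u -> p_superharmonious alpha beta v ->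
  exists a, u x - v x <= u (rcons x a) - v (rcons x a).
Proof.
move=> usub vsup; apply: contrapT => /forallNP noa.
(* Taking the difference at [x] itself as the constant leads to [u x < u x]. *)
have : tree_mean alpha beta u x < tree_mean alpha beta v x + (u x - v x).
  apply: tree_mean_lt => a; have /negP := noa a.
  by rewrite -ltNge ltrBlDl.
have := usub x; have := vsup x; lra.
Qed.

Lemma branch_from_iter x (next : vertex m -> 'I_m) :
  exists pi : branch m, forall n,
    branch_vertex pi (size x + n) = iter n (fun y => rcons y (next y)) x.
Proof.
pose t n := iter n (fun y => rcons y (next y)) x.
(* A branch starts at the root, so its first [size x] coordinates spell out [x]; coordinate [k] is
   then the one appended to the vertex of length [k]. *)
exists (fun k => if (k < size x)%N then nth (next x) x k
                 else next (t (k - size x)%N)).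
elim=> [|n IHn]; last first.
  by rewrite addnS /branch_vertex mkseqS [mkseq _ _]IHn ltnNge leq_addr addKn.
rewrite addn0 /branch_vertex /=.
apply: (@eq_from_nth _ (next x)); rewrite size_mkseq// => i ix.
by rewrite nth_mkseq// ix.
Qed.

(** Only the order of the two limits matters here, so either function may be the solution of the
    Dirichlet problem. *)
Lemma comparison_principle u v :
  p_subharmonious alpha beta u -> p_superharmonious alpha beta v ->
  (forall pi : branch m, exists lu lv : R,
    [/\ u (branch_vertex pi k) @[k --> \oo] --> lu,
        v (branch_vertex pi k) @[k --> \oo] --> lv & lu <= lv]) ->
  forall x, u x <= v x.
Proof.
move=> usub vsup boundary x.
have /boolp.choice[next nextP] y := successor_sub_ge y usub vsup.
have [pi piE] := branch_from_iter x next.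
have [lu [lv [ulu vlv lulv]]] := boundary pi.
pose w y := u y - v y.
have wx n : w x <= w (branch_vertex pi (n + size x)).
  rewrite addnC piE; elim: n => [//|n IHn].
  by rewrite (le_trans IHn)//; exact: nextP.
have : w x <= lu - lv.
  have wl : w (branch_vertex pi k) @[k --> \oo] --> lu - lv by exact: cvgB.
  (* The lower bound on [w] holds only from [x] on, hence the shift by [size x]. *)
  move: wl; rewrite -(cvg_shiftn (size x)) => wl.
  rewrite -(cvg_lim (@Rhausdorff R) wl).
  apply: limr_ge; first by apply/cvg_ex; exists (lu - lv).
  by apply: nearW => n; exact: wx.
rewrite /w; lra.
Qed.

End Comparison.

(** Needed because the boundary data are compared on the unit interval only. *)
Lemma psi_itv01 (R : realType) (m : nat) (pi : branch m) :
  psi R pi \in `[0, 1].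
Proof.
have m_gt0 : (0 < m)%N := leq_ltn_trans (leq0n _) (ltn_ord (pi 0)).
have mR_gt0 : 0 < m%:R :> R by rewrite ltr0n.
set f : R^nat := fun k => (pi k)%:R / m%:R ^+ k.+1.
have f_ge0 k : 0 <= f k by rewrite divr_ge0// exprn_ge0// ltW.
have nd : {homo series f : n p / (n <= p)%N >-> n <= p}.
  apply/nondecreasing_seqP => n.
  by rewrite /series/= big_nat_recr//= lerDl.
(* This sharper bound carries the induction: a digit is at most [m - 1], so the terms are dominated
   by those of a telescoping sum. *)
have le1 n : series f n <= 1 - (m%:R ^+ n)^-1.
  rewrite /series /=; elim: n => [|n IHn].
    by rewrite big_geq// expr0 invr1 subrr.
  rewrite big_nat_recr//= (le_trans (lerD IHn (lexx _)))//.
  have -> : (m%:R ^+ n)^-1 = m%:R / m%:R ^+ n.+1 :> R.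
    by rewrite exprS invfM mulrA divff ?mul1r// gt_eqF.
  have : f n <= (m%:R - 1) / m%:R ^+ n.+1.
    rewrite ler_wpM2r ?invr_ge0 ?exprn_ge0//.
    by rewrite lerBrDr natr1 ler_nat.
  rewrite mulrBl mul1r; lra.
have {}le1 n : series f n <= 1.
  by rewrite (le_trans (le1 n))// gerBl invr_ge0 exprn_ge0// ltW.
have cf : cvgn (series f).
  apply: nondecreasing_is_cvgn => //.
  by exists 1 => _ [n _ <-].
rewrite in_itv/= /psi -/f; apply/andP; split.
  by apply: limr_ge => //; apply: nearW => n; rewrite sumr_ge0.
by apply: limr_le => //; exact: nearW.
Qed.

Theorem theorem3p5 (R : realType) (m : nat) (alpha beta : R)
    (F G : R -> R) (u : vertex m -> R)
    (m_gt2 : (2 < m)%N)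
    (alpha_gt0 : 0 < alpha) (beta_gt0 : 0 < beta)
    (alphaDbeta : alpha + beta = 1)
    (F_bounded : [bounded F t | t in `[0, 1]])
    (G_bounded : [bounded G t | t in `[0, 1]])
    (u_bounded : [bounded u x | x in [set: vertex m]])
    (u_sol : DP_solution alpha beta F u) :
  (forall v : vertex m -> R,
     [bounded v x | x in [set: vertex m]] ->
     DP_supersolution alpha beta G v ->
     (forall t : R, t \in `[0, 1] -> F t <= G t) ->
     forall x : vertex m, u x <= v x)
  /\
  (forall v : vertex m -> R,
     [bounded v x | x in [set: vertex m]] ->
     DP_subsolution alpha beta G v ->
     (forall t : R, t \in `[0, 1] -> G t <= F t) ->
     forall x : vertex m, v x <= u x).
Proof.
have m_gt0 : (0 < m)%N by apply: leq_trans m_gt2.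
have beta_ge0 := ltW beta_gt0.
case: u_sol => -[usub usup] u_lim.
split=> v _ [v_har v_lim] leFG.
- apply: (comparison_principle m_gt0 alpha_gt0 beta_ge0) => // pi.
  have [v_cvg v_ge] := v_lim pi.
  exists (F (psi R pi)), (limn (fun k => v (branch_vertex pi k))).
  by split=> //; rewrite (le_trans _ v_ge)// leFG// psi_itv01.
(* The roles are exchanged: the subsolution [v] now lies below the superharmonious [u]. *)
- apply: (comparison_principle m_gt0 alpha_gt0 beta_ge0) => // pi.
  have [v_cvg v_le] := v_lim pi.
  exists (limn (fun k => v (branch_vertex pi k))), (F (psi R pi)).
  by split=> //; rewrite (le_trans v_le)// leFG// psi_itv01.
Qed.
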